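(* Let $L$ be a bounded lattice. For $V \subseteq J^\infty(L^\delta)$ and $W \subseteq M^\infty(L^\delta)$ define $$u_L(V) := \{y \in M^\infty(L^\delta) \mid \forall x\in V : x \leq y\}, \qquad l_L(W) := \{x \in J^\infty(L^\delta) \mid \forall y \in W : x\leq y\}.$$ Then the maps $u_L$ and $l_L$ restrict to a Galois connection $u_L : D^\wedge(L) \leftrightarrows D^\vee(L)^{\mathrm{op}} : l_L$, where $D^\wedge(L)$ is regarded as a sublattice of $\mathcal P(J^\infty(L^\delta))$ and $D^\vee(L)^{\mathrm{op}}$ as a sublattice of $\mathcal P(M^\infty(L^\delta))$. The lattice of Galois-closed elements of this Galois connection is isomorphic to $L$.
   Context: All lattices are bounded. A canonical extension of $L$ is a lattice embedding $e : L \to C$ into a complete lattice such that (1) every $u \in C$ satisfies $u=\bigvee\{\bigwedge e[S] \mid S \subseteq L, \bigwedge e[S]\leq u\} = \bigwedge\{\bigvee e[T] \mid T\subseteq L, u \leq \bigvee e[T]\}$, and (2) for $S,T \subseteq L$, if $\bigwedge e[S]\leq\bigvee e[T]$ then $\bigwedge S' \leq \bigvee T'$ in $L$ for some finite $S' \subseteq S$, $T'\subseteq T$. It exists and is unique up to isomorphism fixing $L$; it is denoted $L^\delta$, and $L$ is regarded as a sublattice. $J^\infty(L^\delta)$ (resp. $M^\infty(L^\delta)$) is the set of completely join-irreducible (resp. completely meet-irreducible) elements: those $x$ such that $x=\bigvee S$ (resp. $x=\bigwedge S$) implies $x\in S$. For $a\in L$ let $\hat a=\{x\in J^\infty(L^\delta)\mid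 x\leq a\}$ and $\check a=\{y\in M^\infty(L^\delta)\mid a \leq y\}$. The distributive $\wedge$-envelope $D^\wedge(L)$ is identified with the sublattice of $\mathcal P(J^\infty(L^\delta))$ generated by $\{\hat a\mid a\in L\}$ (ordered by inclusion), and the order dual $D^\vee(L)^{\mathrm{op}}$ of the distributive $\vee$-envelope is identified with the sublattice of $\mathcal P(M^\infty(L^\delta))$ generated by $\{\check a\mid a\in L\}$ (ordered by inclusion). A Galois connection between posets $P,Q$ is a contravariant adjunction: order-reversing maps $u : P\leftrightarrows Q : l$ with $\mathrm{id}\leq lu$ and $\mathrm{id}\leq ul$. Galois-closed elements are the $p \in P$ with $lu(p)=p$ (equivalently up to order-reversing bijection the $q \in Q$ with $ul(q)=q$); their lattice carries the order inherited from $P$. *)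

(* Defs.v *)
From mathcomp Require Import all_boot all_order finmap.
From mathcomp Require Import boolp classical_sets functions.

Set Implicit Arguments.
Unset Strict Implicit.
Unset Printing Implicit Defensive.

Local Open Scope order_scope.
Local Open Scope classical_set_scope.

Section CanonicalExtension.
Context {d d' : Order.disp_t} {L : tbLatticeType d} {C : tbLatticeType d'}.

Definition complete_lattice : Prop :=
  forall A : set C, supremums A !=set0 /\ infimums A !=set0.

(* [supremums A u] and [infimums A u] say that [u] is the supremum (infimum)
   of [A]. The embedding has to preserve the bounds: adding a new bottom to
   [C] would not affect density and compactness. It is not declared as a
   [{tblmorphism L -> C}], since that structure only records the preservation
   of the bounds, not of meets and joins. *)
Record canonical_extension (e : {lmorphism L -> C}) : Prop := {
  cext_complete : complete_lattice;
  cext_inj : injective e;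
  cext_bot : e \bot = \bot;
  cext_top : e \top = \top;
  cext_dense_join : forall u : C,
    supremums [set v | exists2 S : set L, infimums (e @` S) v & v <= u] u;
  cext_dense_meet : forall u : C,
    infimums [set v | exists2 T : set L, supremums (e @` T) v & u <= v] u;
  cext_compact : forall (S T : set L) (s t : C),
    infimums (e @` S) s -> supremums (e @` T) t -> s <= t ->
    exists S' T' : {fset L},
      [/\ [set` S'] `<=` S, [set` T'] `<=` T &
          \meet_(a <- S') a <= \join_(b <- T') b]
}.

Definition Jinf : set C := [set x | forall S : set C, supremums S x -> S x].
Definition Minf : set C := [set y | forall S : set C, infimums S y -> S y].

End CanonicalExtension.

Definition sublattice {d : Order.disp_t} {T : latticeType d} (S : set T) :
    Prop :=
  forall x y, S x -> S y -> S (Order.meet x y) /\ S (Order.join x y).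

Section Envelopes.
Context {d d' : Order.disp_t} {L : tbLatticeType d} {C : tbLatticeType d'}.
Variable e : L -> C.

Definition hat (a : L) : set C := [set x | Jinf x /\ x <= e a].
Definition check (a : L) : set C := [set y | Minf y /\ e a <= y].

(* Subsets of [Jinf] and [Minf] are sets in [C]; [set C] is ordered by
   inclusion, with intersection and union as meet and join. The bounds of the
   two power sets are [hat \bot], [hat \top] and [check \top], [check \bot], so
   these are bounded sublattices of the power sets. *)
Definition Dmeet : set (set C) := smallest sublattice (range hat).
Definition Djoin_op : set (set C) := smallest sublattice (range check).

End Envelopes.

Section GaloisMaps.
Context {d' : Order.disp_t} {C : tbLatticeType d'}.

Definition uL (V : set C) : set C :=
  [set y | Minf y /\ forall x, V x -> x <= y].
Definition lL (W : set C) : set C :=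
  [set x | Jinf x /\ forall y, W y -> x <= y].

End GaloisMaps.

(* Posets are subsets [P], [Q] of ordered types, with the induced order; the
   first two fields say that [u] and [l] restrict to maps between them. *)
Section Galois.
Context {d1 d2 : Order.disp_t} {T1 : porderType d1} {T2 : porderType d2}.
Variables (P : set T1) (Q : set T2) (u : T1 -> T2) (l : T2 -> T1).

Record galois_connection : Prop := {
  gc_u_fun : set_fun P Q u;
  gc_l_fun : set_fun Q P l;
  gc_u_anti : forall p p', P p -> P p' -> p <= p' -> u p' <= u p;
  gc_l_anti : forall q q', Q q -> Q q' -> q <= q' -> l q' <= l q;
  gc_lu : forall p, P p -> p <= l (u p);
  gc_ul : forall q, Q q -> q <= u (l q)
}.

Definition galois_closed : set T1 := [set p | P p /\ l (u p) = p].

End Galois.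

Section InducedLattice.
Context {d : Order.disp_t} {T : porderType d}.
Variable K : set T.

(* Bounds computed inside the poset [K], not in [T]. *)
Definition sup_in (A : set T) : set T :=
  [set z | [/\ K z, ubound A z & forall w, K w -> ubound A w -> z <= w]].
Definition inf_in (A : set T) : set T :=
  [set z | [/\ K z, lbound A z & forall w, K w -> lbound A w -> w <= z]].

Definition bounded_lattice : Prop :=
  [/\ sup_in set0 !=set0, inf_in set0 !=set0 &
      forall x y, K x -> K y ->
        sup_in [set x; y] !=set0 /\ inf_in [set x; y] !=set0].

Definition lattice_isomorphism {d' : Order.disp_t} {L : tbLatticeType d'}
    (f : L -> T) : Prop :=
  [/\ set_bij [set: L] K f,
      sup_in set0 (f \bot), inf_in set0 (f \top),
      (forall a b, sup_in [set f a; f b] (f (Order.join a b))) &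
      (forall a b, inf_in [set f a; f b] (f (Order.meet a b)))].

End InducedLattice.

Arguments complete_lattice {d'} C.

(* Main.v *)
Require Import Defs.
From mathcomp Require Import all_boot all_order.
From mathcomp Require Import finmap.
From mathcomp Require Import boolp classical_sets.

(** The three facts behind the theorem are
    [uL (hat a) = check a], [lL (check a) = hat a], and the injectivity of
    [hat]. All of them say that [C] has enough completely irreducible elements:
    [u <= w] as soon as every completely join-irreducible element below [u] is
    below [w] ([Jinf_separates]), and dually ([Minf_separates]).

    By density it is enough to separate a meet [s] of elements of [L] from a
    join [t] of elements of [L] when [~ s <= t]. Zorn's lemma enlarges the
    subset of [L] whose meet is [s] to a maximal one whose meet [x] is still
    not below [t]; compactness is what makes the unions of chains admissible.
    Every element strictly below [x] is a join of meets of still larger subsets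
    of [L], and these meets are below [t] by maximality. Hence the elements
    strictly below [x] have a join below [t], which cannot be [x]: so [x] is
    completely join-irreducible ([exists_Jinf_between]).

    The rest is computation in power sets. As [hat a `&` hat b] is
    [hat (a /\ b)], the members of [Dmeet] are the finite unions of [hat]s; [uL]
    turns such a union into an intersection of [check]s, which is a single
    [check] since [check a `&` check b] is [check (a \/ b)]. So [uL] maps [Dmeet]
    into [range check], dually [lL] maps [Djoin_op] into [range hat], and the
    Galois-closed sets are exactly the [hat a]. The map [hat] is therefore an
    order isomorphism from [L] onto them. *)

Set Implicit Arguments.
Unset Strict Implicit.
Unset Printing Implicit Defensive.

Import Order.TTheory.
Local Open Scope order_scope.
Local Open Scope classical_set_scope.

(** * Finite subsets of unions of chains *)

(** [set0] is thrown in so that the empty chain is covered. *)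
Lemma chain_absorbs_finite {T : eqType} (S0 : set T) (F : set (set T))
    (s : seq T) :
  total_on F subset ->
  [set` s] `<=` S0 `|` \bigcup_(X in F) X ->
  exists2 B, (set0 |` F) B & [set` s] `<=` S0 `|` B.
Proof.
move=> totF; elim: s => [|a s IHs] sub; first by exists set0; [left|].
have [b bs|B FB sB] := IHs.
  by apply: sub; rewrite /= inE; apply/orP; right.
have consP (B' : set T) : (S0 `|` B') a -> [set` s] `<=` S0 `|` B' ->
    [set` a :: s] `<=` S0 `|` B'.
  by move=> aB' sB' b /=; rewrite inE => /orP[/eqP->|/sB'].
have [S0a|[A FA Aa]] : (S0 `|` \bigcup_(X in F) X) a.
- by apply: sub; rewrite /= mem_head.
- by exists B => //; apply: consP => //; left.
have {FB} [BA|[FB AB]] : B `<=` A \/ F B /\ A `<=` B.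
  case: FB => [->|FB]; first by left.
  by have [|] := totF _ _ FA FB; [right|left].
- exists A; first by right.
  apply: consP; first by right.
  by move=> b /sB[]; [left|move=> /BA; right].
- exists B; first by right.
  by apply: consP => //; right; apply: AB.
Qed.

(** * Completely irreducible elements separate *)

(** A form of density and compactness that exchanging [C] with its order dual
    leaves unchanged; since finite meets and joins are only compared in [C], no
    structure on [L] is involved. *)
Record dense_compact {d' : Order.disp_t} {L : choiceType} {C : tbLatticeType d'}
    (e : L -> C) : Prop := {
  dc_complete : complete_lattice C;
  dc_dense_join : forall u : C,
    supremums [set v | exists2 S : set L, infimums (e @` S) v & v <= u] u;
  dc_dense_meet : forall u : C,
    infimums [set v | exists2 T : set L, supremums (e @` T) v & u <= v] u;
  dc_compact : forall (S T : set L) (s t : C),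
    infimums (e @` S) s -> supremums (e @` T) t -> s <= t ->
    exists S' T' : {fset L},
      [/\ [set` S'] `<=` S, [set` T'] `<=` T &
          forall w z, lbound (e @` [set` S']) w -> ubound (e @` [set` T']) z ->
            w <= z]
}.

Lemma dense_compact_dual {d' : Order.disp_t} {L : choiceType}
    {C : tbLatticeType d'} (e : L -> C) :
  dense_compact e -> @dense_compact _ L C^d e.
Proof.
case=> cplt dj dm cpt; split => //.
- by move=> A; have [? ?] := cplt A; split.
- move=> S T s t infs supt st.
  have [S' [T' [S'T T'S le]]] := cpt T S t s supt infs st.
  by exists T', S'; split => // w z lbw ubz; apply: le.
Qed.

Section Separation.
Context {d' : Order.disp_t} {L : choiceType} {C : tbLatticeType d'}.
Variable e : L -> C.
Hypothesis dc : dense_compact e.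

Lemma exists_Jinf_between (S T : set L) (s t : C) :
  infimums (e @` S) s -> supremums (e @` T) t -> ~ s <= t ->
  exists x, [/\ Jinf x, x <= s & ~ x <= t].
Proof.
move=> [lbs infs] supt nst.
pose below (R : set L) := forall w, lbound (e @` R) w -> w <= t.
have [F FP totF|R [nbR maxR]] := @Zorn_bigcup L [set R | ~ below (S `|` R)].
  move=> /= bU.
  have [_ [v vinf]] := dc_complete dc (e @` (S `|` \bigcup_(X in F) X)).
  have [S' [T' [S'S T'T le]]] := dc_compact dc vinf supt (bU _ vinf.1).
  have [B FB S'B] := chain_absorbs_finite totF S'S.
  (* The bound [s] itself handles the case of the empty chain, where [B] is
     empty. *)
  have nB : ~ below (S `|` B).
    case: FB => [->|/FP//] bS; apply: nst; apply: bS.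
    by rewrite setU0.
  apply: nB => w lbw; apply: le.
    by move=> _ [a /S'B aB <-]; apply: lbw; exists a.
  by move=> _ [b /T'T bT <-]; apply: supt.1; exists b.
have [_ [x [lbx infx]]] := dc_complete dc (e @` (S `|` R)).
have nxt : ~ x <= t.
  by move=> xt; apply: nbR => w /infx wx; apply: le_trans xt.
exists x; split => //; last first.
  by apply: infs => _ [a Sa <-]; apply: lbx; exists a => //; left.
move=> A [ubA supA]; apply: contrapT => nAx; apply: nxt.
apply: supA => a Aa.
apply: (dc_dense_join dc a).2 => v [Q [lbv infv] va].
have [QR|nQR] := pselect (Q `<=` R).
  (* Here [x <= v <= a <= x], so that [x] would belong to [A]. *)
  have xv : x <= v.
    by apply: infv => _ [b Qb <-]; apply: lbx; exists b => //; right; apply: QR.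
  suff xa : x = a by case: nAx; rewrite xa.
  by apply/eqP; rewrite eq_le (le_trans xv va) ubA.
have bRQ : below (S `|` (R `|` Q)).
  apply: contrapT; apply: maxR; split; first by move=> b Rb; left.
  by move=> RQ; apply: nQR => b Qb; apply: RQ; right.
apply: bRQ => _ [b [Sb|[Rb|Qb]] <-]; last by apply: lbv; exists b.
- apply: le_trans (le_trans va (ubA _ Aa)) _.
  by apply: lbx; exists b => //; left.
- apply: le_trans (le_trans va (ubA _ Aa)) _.
  by apply: lbx; exists b => //; right.
Qed.

Lemma Jinf_separates (u w : C) :
  (forall x, Jinf x -> x <= u -> x <= w) -> u <= w.
Proof.
move=> Juw.
apply: (dc_dense_join dc u).2 => s [S infs su].
apply: (dc_dense_meet dc w).2 => t [T supt wt].
apply: contrapT => /(exists_Jinf_between infs supt)[x [Jx xs]]; apply.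
by apply: le_trans wt; apply: Juw => //; apply: le_trans su.
Qed.

End Separation.

Lemma Minf_separates {d' : Order.disp_t} {L : choiceType} {C : tbLatticeType d'}
    (e : L -> C) (dc : dense_compact e) (u w : C) :
  (forall y, Minf y -> w <= y -> u <= y) -> u <= w.
Proof. exact: (Jinf_separates (dense_compact_dual dc) (u := w) (w := u)). Qed.

Lemma canonical_extension_dense_compact {d d' : Order.disp_t}
    {L : tbLatticeType d} {C : tbLatticeType d'} (e : {lmorphism L -> C}) :
  canonical_extension e -> dense_compact e.
Proof.
case=> cplt _ e0 e1 dj dm cpt; split => // S T s t infs supt st.
have [S' [T' [S'S T'T le]]] := cpt S T s t infs supt st.
exists S', T'; split => // w z lbw ubz.
have wS : w <= e (\meet_(a <- S') a).
  have {}lbw a : a \in (S' : seq L) -> w <= e a by move=> aS; apply: lbw; exists a.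
  elim: (S' : seq L) lbw => [|a r IHr] lbw; first by rewrite big_nil e1 lex1.
  rewrite big_cons omorphI lexI lbw ?mem_head//=; apply: IHr => b br.
  by apply: lbw; rewrite inE br orbT.
have Tz : e (\join_(b <- T') b) <= z.
  have {}ubz a : a \in (T' : seq L) -> e a <= z by move=> aS; apply: ubz; exists a.
  elim: (T' : seq L) ubz => [|a r IHr] ubz; first by rewrite big_nil e0 le0x.
  rewrite big_cons omorphU leUx ubz ?mem_head//=; apply: IHr => b br.
  by apply: ubz; rewrite inE br orbT.
by apply: le_trans wS (le_trans _ Tz); apply: omorph_le.
Qed.

(** * Sublattices of power sets generated by an intersection-closed family *)

Section Generated.
Context {L X Y : Type}.

Inductive finite_union (h : L -> set X) : set X -> Prop :=
| finite_union_base a : finite_union h (h a)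
| finite_unionU V W :
    finite_union h V -> finite_union h W -> finite_union h (V `|` W).

(** The distributive law pushes intersections down to the generators. *)
Lemma smallest_sublattice_finite_union (h : L -> set X) (m : L -> L -> L) :
  (forall a b, h a `&` h b = h (m a b)) ->
  smallest sublattice (range h) `<=` finite_union h.
Proof.
move=> hI; apply: smallest_sub; last first.
  by move=> _ [a _ <-]; apply: finite_union_base.
move=> V W hV hW; split; last exact: finite_unionU.
rewrite meetEset; elim: hV => {V} [a|V V' _ IHV _ IHV'].
- elim: hW => {W} [b|W W' _ IHW _ IHW']; first by rewrite hI; exact: finite_union_base.
  by rewrite setIUr; apply: finite_unionU.
- by rewrite setIUl; apply: finite_unionU.
Qed.

Lemma sublattice_range_of_union_to_inter (h : L -> set X) (g : L -> set Y)
    (m j : L -> L -> L) (k : set X -> set Y) :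
  (forall a b, h a `&` h b = h (m a b)) ->
  (forall a b, g a `&` g b = g (j a b)) ->
  (forall V W, k (V `|` W) = k V `&` k W) ->
  (forall a, k (h a) = g a) ->
  forall V, smallest sublattice (range h) V -> exists a, k V = g a.
Proof.
move=> hI gI kU kh V /(smallest_sublattice_finite_union hI).
elim=> {V} [a|V W _ [a ka] _ [b kb]]; first by exists a.
by exists (j a b); rewrite kU ka kb gI.
Qed.

Lemma smallest_sublattice_sub (h : L -> set X) (A : set X) :
  (forall a, h a `<=` A) ->
  forall V, smallest sublattice (range h) V -> V `<=` A.
Proof.
move=> hA; apply: smallest_sub => [V W VA WA|_ [a _ <-]]; last exact: hA.
split => [|x [/VA|/WA]//].
by move=> x [/VA].
Qed.

End Generated.

(** * Order embeddings are isomorphisms onto their image *)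

Lemma order_embedding_isomorphism {d d' : Order.disp_t} {T : porderType d}
    {L : tbLatticeType d'} (f : L -> T) (K : set T) :
  {mono f : a b / a <= b} -> range f = K -> lattice_isomorphism K f.
Proof.
move=> fle <-; have fK a : range f (f a) by exists a.
split.
- split=> [a _ //|a b _ _ fab|_ [a _ <-]]; last by exists a.
  by apply/eqP; rewrite eq_le -!fle fab lexx.
- by split=> // _ [c _ <-] _; rewrite fle le0x.
- by split=> // _ [c _ <-] _; rewrite fle lex1.
- move=> a b; split=> [//|_ [|] ->|_ [c _ <-] ub]; rewrite fle ?leUl ?leUr//.
  by rewrite leUx -!fle !ub//; [right|left].
- move=> a b; split=> [//|_ [|] ->|_ [c _ <-] lb]; rewrite fle ?leIl ?leIr//.
  by rewrite lexI -!fle !lb//; [right|left].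
Qed.

Lemma lattice_isomorphism_bounded {d d' : Order.disp_t} {T : porderType d}
    {L : tbLatticeType d'} (f : L -> T) (K : set T) :
  lattice_isomorphism K f -> bounded_lattice K.
Proof.
move=> [[_ _ surj] f0 f1 fU fI]; split; [by exists (f \bot)|by exists (f \top)|].
move=> x y /surj[a _ <-] /surj[b _ <-].
by split; [exists (f (Order.join a b))|exists (f (Order.meet a b))].
Qed.

(** * The Galois connection *)

Section Polarity.
Context {d d' : Order.disp_t} {L : tbLatticeType d} {C : tbLatticeType d'}.
Variable e : {lmorphism L -> C}.

Lemma hatI a b : hat e a `&` hat e b = hat e (Order.meet a b).
Proof.
apply/seteqP; split=> x; rewrite /hat /= omorphI lexI.
  by move=> [[Jx ->] [_ ->]].
by move=> [Jx /andP[-> ->]].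
Qed.

Lemma checkI a b : check e a `&` check e b = check e (Order.join a b).
Proof.
apply/seteqP; split=> x; rewrite /check /= omorphU leUx.
  by move=> [[Mx ->] [_ ->]].
by move=> [Mx /andP[-> ->]].
Qed.

Lemma uLU (V W : set C) : uL (V `|` W) = uL V `&` uL W.
Proof.
apply/seteqP; split=> y.
  by move=> [My VWy]; split; split=> // x xVW; apply: VWy; [left|right].
by move=> [[My Vy] [_ Wy]]; split=> // x [/Vy|/Wy].
Qed.

Lemma lLU (V W : set C) : lL (V `|` W) = lL V `&` lL W.
Proof.
apply/seteqP; split=> x.
  by move=> [Jx VWx]; split; split=> // y yVW; apply: VWx; [left|right].
by move=> [[Jx Vx] [_ Wx]]; split=> // y [/Vx|/Wx].
Qed.

Hypothesis eP : canonical_extension e.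
Let dc := canonical_extension_dense_compact eP.

(** [e a] is the join of [hat a]. *)
Lemma uL_hat a : uL (hat e a) = check e a.
Proof.
apply/seteqP; split=> y [My ay]; split=> //.
  by apply: (Jinf_separates dc) => x Jx xa; apply: ay.
by move=> x [_ xa]; apply: le_trans ay.
Qed.

(** [e a] is the meet of [check a]. *)
Lemma lL_check a : lL (check e a) = hat e a.
Proof.
apply/seteqP; split=> x [Jx xa]; split=> //.
  by apply: (Minf_separates dc) => y My ay; apply: xa.
by move=> y [_ ay]; apply: le_trans ay.
Qed.

Lemma hat_mono : {mono hat e : a b / a <= b}.
Proof.
move=> a b; apply/idP/idP => [/subsetPset ab|ab].
  have eab : e a <= e b.
    by apply: (Jinf_separates dc) => x Jx xa; have [] : hat e b x by apply: ab.
  by apply/meet_idPl/(cext_inj eP); rewrite omorphI; apply/meet_idPl.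
by apply/subsetPset => x [Jx xa]; split=> //; apply: le_trans xa (omorph_le _ ab).
Qed.

Lemma uL_Dmeet V : Dmeet e V -> exists a, uL V = check e a.
Proof. exact: (sublattice_range_of_union_to_inter hatI checkI uLU uL_hat). Qed.

Lemma lL_Djoin_op W : Djoin_op e W -> exists a, lL W = hat e a.
Proof. exact: (sublattice_range_of_union_to_inter checkI hatI lLU lL_check). Qed.

Lemma Dmeet_hat a : Dmeet e (hat e a).
Proof. by apply: sub_gen_smallest; exists a. Qed.

Lemma Djoin_op_check a : Djoin_op e (check e a).
Proof. by apply: sub_gen_smallest; exists a. Qed.

Lemma uL_lL_galois : galois_connection (Dmeet e) (Djoin_op e) uL lL.
Proof.
split.
- by move=> V /uL_Dmeet[a ->]; exact: Djoin_op_check.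
- by move=> W /lL_Djoin_op[a ->]; exact: Dmeet_hat.
- move=> V V' _ _ /subsetPset VV'; apply/subsetPset => y [My V'y].
  by split=> // x /VV'/V'y.
- move=> W W' _ _ /subsetPset WW'; apply/subsetPset => x [Jx W'x].
  by split=> // y /WW'/W'x.
- move=> V DV; apply/subsetPset => x Vx; split=> [|y [_]]; last exact.
  by apply: (smallest_sublattice_sub _ DV) Vx => a z [].
- move=> W DW; apply/subsetPset => y Wy; split=> [|x [_]]; last exact.
  by apply: (smallest_sublattice_sub _ DW) Wy => a z [].
Qed.

Lemma galois_closed_hat : range (hat e) = galois_closed (Dmeet e) uL lL.
Proof.
apply/seteqP; split=> [_ [a _ <-]|V [DV luV]].
  by split; [exact: Dmeet_hat|rewrite uL_hat lL_check].
by have [a uV] := uL_Dmeet DV; exists a => //; rewrite -luV uV lL_check.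
Qed.

End Polarity.

Theorem proposition3p18 (d d' : Order.disp_t)
    (L : tbLatticeType d) (C : tbLatticeType d')
    (e : {lmorphism L -> C}) (eP : canonical_extension e) :
  galois_connection (Dmeet e) (Djoin_op e) uL lL /\
  (let closed := galois_closed (Dmeet e) uL lL in
   bounded_lattice closed /\
   exists f : L -> set C, lattice_isomorphism closed f).
Proof.
split; first exact: uL_lL_galois.
have hat_iso := order_embedding_isomorphism (hat_mono eP) (galois_closed_hat eP).
by split; [exact: lattice_isomorphism_bounded hat_iso|exists (hat e)].
Qed.
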